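(* Let $\Omega\subset\mathbb{R}^2$ be a bounded domain with smooth boundary. There is no function $u\in C^\infty(\Omega)\cap C^0(\overline{\Omega})$ with $u>0$ in $\Omega$, $u=0$ along $\partial\Omega$, and $$\mathrm{div}\left(\frac{Du}{\sqrt{1+|Du|^2}}\right)=\frac{2}{\sqrt{1+|Du|^2}}\,\frac{1-u}{u^2}\quad\text{in }\Omega .$$ That is, the Dirichlet problem at infinity for this equation has no solutions.
   Context: Here $D$, $\mathrm{div}$ and $|\cdot|$ are the Euclidean gradient, divergence and norm in $\mathbb{R}^2$. (The equation says that the graph $z=u(x,y)$ is a horo-shrinker in the upper half-space model of hyperbolic space $\mathbb{H}^3$, and $\mathbb{R}^2=\{z=0\}$ is regarded as a subset of the ideal boundary.) *)

(* Defs.v *)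
From mathcomp Require Import all_boot all_order all_algebra.
From mathcomp Require Import all_classical all_reals all_analysis.

Set Implicit Arguments.
Unset Strict Implicit.
Unset Printing Implicit Defensive.

Import Order.TTheory GRing.Theory Num.Theory.
Import numFieldNormedType.Exports.

Local Open Scope classical_set_scope.
Local Open Scope ring_scope.

(* R^n is 'rV[R]_n.  The library norm `|v| on it is the sup norm; it defines the
   usual topology and bounded sets, but the Euclidean norm in the equation is
   [enorm]. *)

Definition enorm (R : realType) (n : nat) (v : 'rV[R]_n) : R :=
  Num.sqrt (\sum_(i < n) v 0 i ^+ 2).

Definition partial (R : realType) (n : nat) (i : 'I_n) (f : 'rV[R]_n -> R)
    (x : 'rV[R]_n) : R :=
  'D_(delta_mx 0 i) f x.

Definition grad (R : realType) (n : nat) (f : 'rV[R]_n -> R) (x : 'rV[R]_n) :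
    'rV[R]_n :=
  \row_(i < n) partial i f x.

Definition div (R : realType) (n : nat) (V : 'rV[R]_n -> 'rV[R]_n)
    (x : 'rV[R]_n) : R :=
  \sum_(i < n) partial i (fun y => V y 0 i) x.

(* Only meant for open A: the limits and derivatives at a point of A then depend
   only on the values of f on A. *)
Fixpoint Ck_on (R : realType) (n : nat) (k : nat) (A : set 'rV[R]_n)
    (f : 'rV[R]_n -> R) : Prop :=
  (forall x, A x -> {for x, continuous f}) /\
  (if k is k'.+1 then
     forall i : 'I_n,
       (forall x, A x -> derivable f x (delta_mx 0 i)) /\
       Ck_on k' A (partial i f)
   else True).

Definition smooth_on (R : realType) (n : nat) (A : set 'rV[R]_n)
    (f : 'rV[R]_n -> R) : Prop :=
  forall k, Ck_on k A f.

Definition boundary (T : topologicalType) (A : set T) : set T :=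
  closure A `\` interior A.

Definition domain (T : topologicalType) (A : set T) : Prop :=
  [/\ A !=set0, open A & connected A].

(* Near each boundary point A is a sublevel set {rho < 0} of a smooth submersion
   rho; in particular A lies locally on one side of its boundary {rho = 0}. *)
Definition smooth_boundary (R : realType) (n : nat) (A : set 'rV[R]_n) : Prop :=
  forall p, boundary A p ->
    exists (U : set 'rV[R]_n) (rho : 'rV[R]_n -> R),
      [/\ open U, U p, smooth_on U rho,
          (forall q, U q -> grad rho q != 0) &
          (forall q, U q -> (A q <-> rho q < 0))].

(* Main.v *)
Require Import Defs.
From mathcomp Require Import all_boot all_order all_algebra.
From mathcomp Require Import all_classical all_reals all_analysis.
From mathcomp Require Import ring lra.

Import Order.TTheory GRing.Theory Num.Theory.
Import numFieldNormedType.Exports.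

Local Open Scope classical_set_scope.
Local Open Scope ring_scope.

(** Write rho(z) = ln z + z^3.  The proof compares the graph of u with the
    cylinders k x = rho(z) + const, invariant in the second direction, on which
    z runs through all positive values: they leave the ideal boundary z = 0 at
    x = -oo and climb beyond any prescribed height.  For k large they are strict
    supersolutions of the equation at all heights 0 < z <= max u, whereas u is a
    solution, so that no such cylinder can touch the graph of u from above; but
    sliding one of them along the first axis produces a contact.

    The sliding is replaced by one maximization.  The function
    E(x) = u e^(u^3) e^(-k x_0) is continuous on the compact set
    closure Omega, positive in Omega and zero on the boundary, so it is maximal
    at some p in Omega.  There H = ln E = rho(u) - k x_0 is maximal too, and the
    first and second derivative tests along the two axes give
      rho'(u) u_0 = k,   rho'(u) u_00 + rho''(u) u_0^2 <= 0,
      u_1 = 0,           u_11 <= 0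
    ([barrier_max_along_line]).  Since Du is parallel to the first axis at p,
    the equation reads there
      u_00 / W^3 + u_11 / W = (2 / W) (1 - u) / u^2,   W^2 = 1 + u_0^2
    ([div_normalized_grad_aligned]).  Eliminating u_00 and u_11 yields
      k^2 (u^2 rho'' - 2 (u - 1) rho') <= 2 (u - 1) rho'^3,
    where the factor u^2 rho'' - 2 (u - 1) rho' = 2/u + 6 u^2 - 3 is at least 1
    at every u > 0.  The right-hand side is nonpositive when u <= 1, and bounded
    in terms of max u otherwise, so a large k gives a contradiction
    ([horo_equation_barrier]).

    The two terms of rho serve the two ends of the range of heights.  The
    logarithm sends the foot of the cylinder to x = -oo, and there the singular
    term 2 (1 - u) / u^2 of the equation leaves room for its convexity.  Above
    height 1 the equation forces concavity, and 3 is the least exponent a for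
    which rho = z^a satisfies z^2 rho'' >= 2 z rho'. *)

(** * Derivatives along lines *)

Lemma derive_along_line (R : realType) (n : nat) (f : 'rV[R]_n -> R)
    (p v : 'rV[R]_n) :
  'D_v f p = 'D_1 (fun t : R => f (t *: v + p)) 0.
Proof.
rewrite /derive; set q := (X in _ = lim (X @ _)).
suff <- : (fun h => h^-1 *: ((f \o shift p) (h *: v) - f p)) = q by [].
by apply/funext => h; rewrite /q /= addr0 scale0r add0r [h%:A]mulr1.
Qed.

Lemma is_derive_along_line (R : realType) (n : nat) (f : 'rV[R]_n -> R)
    (p v : 'rV[R]_n) (t : R) :
  derivable f (t *: v + p) v ->
  is_derive t 1 (fun s : R => f (s *: v + p)) ('D_v f (t *: v + p)).
Proof.
have quotE : (fun h : R => h^-1 *: (((fun s => f (s *: v + p)) \o shift t)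
    (h *: 1) - f (t *: v + p))) =
    (fun h : R => h^-1 *: ((f \o shift (t *: v + p)) (h *: v) -
    f (t *: v + p))).
  by apply/funext => h /=; rewrite [h%:A]mulr1 scalerDl addrA.
move=> df; apply: DeriveDef; first by rewrite /derivable quotE.
by rewrite /derive quotE.
Qed.

Lemma near_along_line (R : realType) (n : nat) (p v : 'rV[R]_n)
    (P : set 'rV[R]_n) :
  (\forall x \near p, P x) -> \forall t \near (0 : R), P (t *: v + p).
Proof.
have cl : continuous (fun t : R => t *: v + p).
  by move=> t; apply: cvgD; [exact: scalel_continuous|exact: cvg_cst].
by have := cl 0; rewrite /continuous_at scale0r add0r => + Pp; apply.
Qed.

(** * Second-order conditions at a maximum *)

(** If the second derivative were positive, the difference quotients of [dg] at
    its zero [a] would make [dg] positive just to the right of [a], and the mean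
    value theorem would make [g] exceed [g a] there. *)
Lemma second_derivative_at_max (R : realType) (g dg : R -> R) (a d2g : R) :
  (\forall t \near a, is_derive (t : R) 1 g (dg t)) ->
  is_derive a 1 dg d2g ->
  (\forall t \near a, g t <= g a) ->
  dg a = 0 /\ d2g <= 0.
Proof.
move=> Dg Ddg gmax.
have /nbhs_ballP[e /= e0 He] : \forall t \near a,
  is_derive (t : R) 1 g (dg t) /\ g t <= g a.
  by near=> t; split; near: t.
have {}He (t : R) : t \in `]a - e, a + e[ -> is_derive t 1 g (dg t) /\ g t <= g a.
  by rewrite in_itv/= => ?; apply: He; rewrite ball_itv/= in_itv/=.
have aI : a \in `]a - e, a + e[ by rewrite in_itv/= ltrDl gtrBl e0.
have dga0 : dg a = 0.
  have [Da _] := He _ aI.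
  have D0 : is_derive a 1 g 0.
    apply: (@derive1_at_max _ g (a - e) (a + e)) => //.
    - by rewrite lerD2l ge0_cp// ltW.
    - by move=> t /He[[]].
    - by move=> t /He[].
  by rewrite -(@derive_val _ _ _ _ _ _ _ Da) (@derive_val _ _ _ _ _ _ _ D0).
split=> //; rewrite leNgt; apply/negP => d2g0.
have cdg := @ex_derive _ _ _ _ _ _ _ Ddg.
have Ed2 := @derive_val _ _ _ _ _ _ _ Ddg.
have : \forall h \near (0 : R)^',
    0 < h^-1 *: ((dg \o shift a) (h *: 1) - dg a).
  by apply: (@cvgr_gt _ _ _ _ _ _ cdg); rewrite -/(derive dg a 1) Ed2.
rewrite near_withinE => /nbhs_ballP[d /= d0 Hd].
(* [a + m] stays in both the maximality and the positivity neighbourhoods. *)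
pose m := Num.min e d / 2.
have min0 : 0 < Num.min e d by rewrite lt_min e0 d0.
have m0 : 0 < m by rewrite divr_gt0.
have mem : m < Num.min e d by rewrite gtr_pMr// invf_lt1// ltr1n.
move: (mem); rewrite lt_min => /andP[me md].
have inI t : t \in `[a, a + m] -> t \in `]a - e, a + e[.
  by rewrite !in_itv/=; lra.
have dg_gt0 t : t \in `]a, a + m[ -> 0 < dg t.
  rewrite in_itv/= => /andP[a_t t_am].
  have := Hd (t - a); rewrite -ball_normE/= sub0r normrN gtr0_norm ?subr_gt0//.
  rewrite [(t - a)%:A]mulr1 dga0 subr0 subrK => /(_ _ _)/=.
  have -> : t - a < d by lra.
  move=> /(_ isT); rewrite gt_eqF ?subr_gt0// => /(_ isT).
  by rewrite /GRing.scale/= pmulr_rgt0// invr_gt0 subr_gt0.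
have [|||c cI gaE] := @MVT _ g dg a (a + m).
- by rewrite ltrDl.
- by move=> x xI; have [] := He x (inI x (subset_itv_oo_cc xI)).
- by apply: derivable_within_continuous => x /inI/He[[]].
have /He[_] : a + m \in `]a - e, a + e[ by apply: inI; rewrite in_itv/=; lra.
by rewrite -subr_le0 gaE leNgt mulr_gt0 ?dg_gt0//; lra.
Unshelve. all: by end_near. Qed.

(** The coefficients are rho'(g) and rho''(g) for rho(z) = ln z + z^3: the two
    conclusions say that rho(g) - k t has zero first derivative and nonpositive
    second derivative at its maximum. *)
Lemma barrier_max_along_line (R : realType) (g dg : R -> R) (a k d2g : R) :
  (\forall t \near a, is_derive (t : R) 1 g (dg t)) ->
  is_derive a 1 dg d2g ->
  (\forall t \near a, 0 < g t) ->
  (\forall t \near a,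
     ln (g t) + g t ^+ 3 - k * t <= ln (g a) + g a ^+ 3 - k * a) ->
  ((g a)^-1 + 3 * g a ^+ 2) * dg a = k /\
  ((g a)^-1 + 3 * g a ^+ 2) * d2g + (6 * g a - (g a)^-1 ^+ 2) * dg a ^+ 2 <= 0.
Proof.
move=> Dg Ddg g0 hmax.
have ga0 : 0 < g a := nbhs_singleton g0.
have Dga : is_derive a 1 g (dg a) := nbhs_singleton Dg.
have [|||E1 E2] := @second_derivative_at_max R
  (fun t => ln (g t) + g t ^+ 3 - k * t)
  (fun t => ((g t)^-1 + 3 * g t ^+ 2) * dg t - k) a
  (((g a)^-1 + 3 * g a ^+ 2) * d2g + (6 * g a - (g a)^-1 ^+ 2) * dg a ^+ 2).
- near=> t.
  have gt0 : 0 < g t by near: t.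
  have Dt : is_derive t 1 g (dg t) by near: t.
  have Dl : is_derive t 1 (@ln R \o g) ((g t)^-1 * dg t).
    exact: (is_derive1_comp (is_derive1_ln gt0) Dt).
  have D := is_deriveB (is_deriveD Dl (is_deriveX 3 Dt))
    (is_deriveZ k (is_derive_id t (1 : R))).
  apply: (is_derive_eq D); rewrite /GRing.scale/=; ring.
- have Dv := @is_deriveV _ _ _ _ _ (lt0r_neq0 ga0) Dga.
  have D := is_deriveB
    (is_deriveM (is_deriveD Dv (is_deriveZ 3 (is_deriveX 2 Dga))) Ddg)
    (is_derive_cst k a (1 : R)).
  apply: (is_derive_eq D); rewrite !fctE /= /GRing.scale/=; field.
  by rewrite lt0r_neq0.
- exact: hmax.
by split=> //; apply/eqP; rewrite -subr_eq0 E1.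
Unshelve. all: by end_near. Qed.

(** * The mean curvature operator *)

(** The quotient rule: the derivative of W = sqrt (1 + |Du|^2) in the i-th
    direction is (sum_j u_j u_ji) / W. *)
Lemma div_normalized_grad (R : realType) (n : nat) (u : 'rV[R]_n -> R)
    (p : 'rV[R]_n) :
  (forall i j, derivable (partial j u) p (delta_mx 0 i)) ->
  let W := Num.sqrt (1 + enorm (grad u p) ^+ 2) in
  div (fun y => (Num.sqrt (1 + enorm (grad u y) ^+ 2))^-1 *: grad u y) p =
  \sum_i (partial i (partial i u) p / W -
    partial i u p * (\sum_j partial j u p * partial i (partial j u) p) / W ^+ 3).
Proof.
move=> du W; rewrite /div; apply: eq_bigr => i _.
(* The chain rule for the square root is one-dimensional, so everything is
   restricted to the line through [p] in the [i]-th direction. *)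
pose b j (t : R) := partial j u (t *: delta_mx 0 i + p).
have b0 j : b j 0 = partial j u p by rewrite /b scale0r add0r.
have Db j : is_derive (0 : R) 1 (b j) (partial i (partial j u) p).
  have := @is_derive_along_line R n (partial j u) p (delta_mx 0 i) 0.
  by rewrite scale0r add0r; apply; exact: du.
pose S := 1 + (\sum_j (b j) ^+ 2) : R -> R.
have SE t : S t = 1 + enorm (grad u (t *: delta_mx 0 i + p)) ^+ 2.
  rewrite /enorm sqr_sqrtr; last by apply: sumr_ge0 => j _; exact: sqr_ge0.
  rewrite /S !fctE fct_sumE; congr (_ + _).
  by apply: eq_bigr => j _; rewrite mxE.
have S0 : 0 < S 0 by rewrite SE ltr_wpDr// sqr_ge0.
have WE : W = Num.sqrt (S 0) by rewrite SE scale0r add0r.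
have W0 : 0 < W by rewrite WE sqrtr_gt0.
have DS : is_derive (0 : R) 1 S
    (2 * \sum_j partial j u p * partial i (partial j u) p).
  apply: is_derive_eq.
  rewrite add0r mulr_sumr; apply: eq_bigr => j _.
  by rewrite b0 /GRing.scale/= expr1; ring.
set T := \sum_j partial j u p * partial i (partial j u) p in DS *.
have DW : is_derive (0 : R) 1 (Num.sqrt \o S) (T / W).
  apply: (@is_derive_eq _ _ _ _ _ _ _ _ (is_derive1_comp (is_derive1_sqrt S0) DS)).
  by rewrite -WE; field; rewrite lt0r_neq0.
have W0' : (Num.sqrt \o S) 0 != 0 by rewrite /= -WE lt0r_neq0.
have DV := is_deriveV W0' DW.
rewrite [LHS]/partial derive_along_line.
have -> : (fun t : R => ((Num.sqrt
     (1 + enorm (grad u (t *: delta_mx 0 i + p)) ^+ 2))^-1 *: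
     grad u (t *: delta_mx 0 i + p)) 0 i) =
   (fun t => ((Num.sqrt \o S) t)^-1) * b i.
  by apply/funext => t; rewrite !mxE !fctE /= SE.
rewrite derive_val /= b0 -WE /GRing.scale/=; field.
by rewrite lt0r_neq0.
Qed.

Lemma sum_ord2 (R : nmodType) (F : 'I_2 -> R) : \sum_i F i = F 0 + F 1.
Proof. by rewrite big_ord_recl big_ord1; congr (_ + F _); exact: val_inj. Qed.

Lemma sqr_enorm_grad_aligned (R : realType) (u : 'rV[R]_2 -> R)
    (p : 'rV[R]_2) :
  partial 1 u p = 0 -> enorm (grad u p) ^+ 2 = partial 0 u p ^+ 2.
Proof.
move=> p1; rewrite sqr_sqrtr; last by apply: sumr_ge0 => j _; exact: sqr_ge0.
by rewrite sum_ord2 !mxE p1 expr0n/= addr0.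
Qed.

(** When Du points along the first axis, the mixed second derivatives drop out,
    so that maximality along the two axes alone controls the operator. *)
Lemma div_normalized_grad_aligned (R : realType) (u : 'rV[R]_2 -> R)
    (p : 'rV[R]_2) :
  (forall i j, derivable (partial j u) p (delta_mx 0 i)) ->
  partial 1 u p = 0 ->
  let W := Num.sqrt (1 + partial 0 u p ^+ 2) in
  div (fun y => (Num.sqrt (1 + enorm (grad u y) ^+ 2))^-1 *: grad u y) p =
  partial 0 (partial 0 u) p / W
  - partial 0 u p * (partial 0 u p * partial 0 (partial 0 u) p) / W ^+ 3
  + partial 1 (partial 1 u) p / W.
Proof.
move=> du p1 W; rewrite div_normalized_grad// sqr_enorm_grad_aligned// -/W.
have sums (a : 'I_2 -> R) (b : 'I_2 -> 'I_2 -> R) : a 1 = 0 ->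
    \sum_i (b i i / W - a i * (\sum_j a j * b i j) / W ^+ 3) =
    b 0 0 / W - a 0 * (a 0 * b 0 0) / W ^+ 3 + b 1 1 / W.
  by move=> a1; rewrite !sum_ord2 a1 !mul0r !addr0 subr0.
exact: (sums (fun i => partial i u p) (fun i j => partial i (partial j u) p)).
Qed.

(** * Comparison with a cylinder *)

(** The cylinder k x = rho(z) + const is a strict supersolution at the height
    [v]: no function whose first and second derivatives [p], [q1], [q2] are those
    allowed by a contact from below solves the equation there.  The value of [k]
    beats 2 (v - 1) rho'(v)^3 for 1 < v <= M, using rho'(v) <= 1 + 3 M^2, and is
    larger than 1 so that k <= k^2. *)
Lemma horo_equation_barrier (R : realType) (v M k p q1 q2 : R) :
  0 < v -> v <= M ->
  k = 1 + 2 * M * (1 + 3 * M ^+ 2) ^+ 3 ->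
  (v^-1 + 3 * v ^+ 2) * p = k ->
  (v^-1 + 3 * v ^+ 2) * q1 + (6 * v - v^-1 ^+ 2) * p ^+ 2 <= 0 ->
  q2 <= 0 ->
  let W := Num.sqrt (1 + p ^+ 2) in
  q1 / W - p * (p * q1) / W ^+ 3 + q2 / W <> 2 / W * ((1 - v) / v ^+ 2).
Proof.
move=> v0 vM kE r_p r_q1 q20 W.
have W2 : W ^+ 2 = 1 + p ^+ 2 by rewrite sqr_sqrtr// addr_ge0// sqr_ge0.
have W0 : 0 < W by rewrite sqrtr_gt0 ltr_wpDr// sqr_ge0.
have v_neq0 : v != 0 by rewrite lt0r_neq0.
have W_neq0 : W != 0 by rewrite lt0r_neq0.
move=> pde.
(* The equation multiplied by W^3 v^2. *)
have {}pde : q1 * v ^+ 2 + W ^+ 2 * q2 * v ^+ 2 = 2 * W ^+ 2 * (1 - v).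
  have -> : 2 * W ^+ 2 * (1 - v) = 2 / W * ((1 - v) / v ^+ 2) * (W ^+ 3 * v ^+ 2).
    by field; rewrite v_neq0 W_neq0.
  rewrite -pde.
  have -> : q1 * v ^+ 2 = q1 * (W ^+ 2 - p ^+ 2) * v ^+ 2 by rewrite W2; ring.
  by field; rewrite W_neq0.
set r := v^-1 + 3 * v ^+ 2 in r_p r_q1.
have r0 : 0 < r by rewrite addr_gt0 ?invr_gt0// mulr_gt0// exprn_gt0.
(* L = v^2 rho''(v) - 2 (v - 1) rho'(v). *)
pose L := 2 * v^-1 + 6 * v ^+ 2 - 3.
have vV : v * v^-1 = 1 by rewrite divff.
have L1 : 1 <= L.
  have vi0 : 0 < v^-1 by rewrite invr_gt0.
  rewrite /L; set w := v^-1 in vV vi0 *.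
  (* 1/v lies above its tangent 4 - 4 v at v = 1/2, and what is left is a
     positive quadratic polynomial. *)
  have : 0 <= (2 * v - 1) ^+ 2 * w.
    by rewrite mulr_ge0 ?sqr_ge0 ?ltW.
  have -> : (2 * v - 1) ^+ 2 * w = 4 * v * (v * w) - 4 * (v * w) + w by ring.
  rewrite vV; have := sqr_ge0 (3 * v - 2); rewrite sqrrB; nra.
have r2_k : r ^+ 2 * p ^+ 2 = k ^+ 2 by rewrite -r_p; ring.
have {}ineq : k ^+ 2 * L <= 2 * (v - 1) * r ^+ 3.
  have : r ^+ 2 * (2 * W ^+ 2 * (1 - v) * r) <=
         r ^+ 2 * (- (6 * v - v^-1 ^+ 2) * p ^+ 2 * v ^+ 2).
    rewrite ler_wpM2l ?sqr_ge0// -pde.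
    (* [q1] is bounded above by [r_q1], and the [q2] term has the right sign. *)
    have v2 : 0 < v ^+ 2 by rewrite exprn_gt0.
    have W2q : 0 <= r * v ^+ 2 * W ^+ 2 * - q2.
      by rewrite mulr_ge0 ?oppr_ge0// !mulr_ge0 ?sqr_ge0// ltW.
    have := ler_wpM2r (ltW v2) r_q1; rewrite mul0r; lra.
  rewrite W2.
  have -> : r ^+ 2 * (2 * (1 + p ^+ 2) * (1 - v) * r) =
     2 * (1 - v) * r ^+ 3 + (r ^+ 2 * p ^+ 2) * (2 * (1 - v) * r) by ring.
  have -> : r ^+ 2 * (- (6 * v - v^-1 ^+ 2) * p ^+ 2 * v ^+ 2) =
     (r ^+ 2 * p ^+ 2) * - (6 * v ^+ 3 - 1) by field.
  rewrite r2_k.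
  have -> : k ^+ 2 * L = k ^+ 2 * (2 * (1 - v) * r) + k ^+ 2 * (6 * v ^+ 3 - 1).
    by rewrite /L /r; field.
  lra.
have M0 : 0 < M := lt_le_trans v0 vM.
have M3 : 0 < 1 + 3 * M ^+ 2 by rewrite ltr_wpDr// mulr_ge0// sqr_ge0.
have k1 : 1 < k by rewrite kE ltrDl !mulr_gt0// exprn_gt0.
have {}ineq : k < 2 * (v - 1) * r ^+ 3.
  apply: lt_le_trans ineq; apply: (@lt_le_trans _ _ (k ^+ 2)).
    by rewrite expr2 ltr_pMr// (lt_trans ltr01).
  by rewrite ler_peMr// sqr_ge0.
have [v1|v1] := leP v 1.
  have : 2 * (v - 1) * r ^+ 3 <= 0.
    by rewrite mulr_le0_ge0 ?exprn_ge0 ?(ltW r0)//; lra.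
  lra.
have : 2 * (v - 1) * r ^+ 3 <= 2 * M * (1 + 3 * M ^+ 2) ^+ 3.
  apply: ler_pM; rewrite ?exprn_ge0 ?(ltW r0)//; [lra|lra|].
  rewrite lerXn2r ?nnegrE ?(ltW r0) ?(ltW M3)//.
  apply: lerD; first by rewrite invf_le1// ltW.
  by rewrite ler_pM2l// lerXn2r ?nnegrE ?(ltW v0) ?(ltW M0).
by rewrite kE in ineq; lra.
Qed.

(** * Nonexistence *)

Lemma bounded_closure (R : realType) (n : nat) (A : set 'rV[R]_n) :
  bounded_set A -> bounded_set (closure A).
Proof.
move=> bA; rewrite /= /bounded_near; near=> r.
suff : closure A `<=` [set x | `|x| <= r] by [].
have Ar : A `<=` [set x | `|x| <= r] by near: r.
have cr : closed [set x : 'rV[R]_n | `|x| <= r].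
  apply: (@closed_comp _ _ (Num.norm : 'rV[R]_n -> R) [set s | s <= r]).
    by move=> x _; exact: norm_continuous.
  exact: closed_le.
by rewrite ((closure_id _).1 cr); exact: closureS.
Unshelve. all: by end_near. Qed.

Theorem theorem3p7 (R : realType) (Omega : set 'rV[R]_2)
    (Omega_domain : domain Omega)
    (Omega_bounded : bounded_set Omega)
    (Omega_smooth : smooth_boundary Omega) :
  ~ exists u : 'rV[R]_2 -> R,
      [/\ smooth_on Omega u,
          {within closure Omega, continuous u},
          (forall x, Omega x -> 0 < u x),
          (forall x, boundary Omega x -> u x = 0) &
          (forall x, Omega x ->
             div (fun y => (Num.sqrt (1 + enorm (grad u y) ^+ 2))^-1 *: grad u y) x
             = 2 / Num.sqrt (1 + enorm (grad u x) ^+ 2)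
               * ((1 - u x) / u x ^+ 2))].
Proof.
case=> u [u_smooth u_cont u_gt0 u_bd pde].
have [[x0 Ox0] Oopen _] := Omega_domain.
have subO : Omega `<=` closure Omega := @subset_closure _ _.
have clO0 : closure Omega !=set0 by exists x0; exact: subO.
have clOc : compact (closure Omega).
  apply: bounded_closed_compact; last exact: closed_closure.
  exact: bounded_closure.
have [c cO cmax] := EVT_max_rV clO0 clOc u_cont.
set M := u c in cmax.
pose k := 1 + 2 * M * (1 + 3 * M ^+ 2) ^+ 3.
pose E (y : 'rV[R]_2) := u y * expR (u y ^+ 3) * expR (- k * y 0 0).
have E_cont : {within closure Omega, continuous E}.
  move=> x; apply: cvgM; first apply: cvgM.
  - exact: u_cont.
  - apply: (@within_continuous_comp _ _ _ _ u (fun s => expR (s ^+ 3))) => // s _.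
    by apply: continuous_comp; [exact: exprn_continuous|exact: continuous_expR].
  - apply: (@continuous_subspaceT _ _ _ (fun y : 'rV[R]_2 => expR (- k * y 0 0))).
    move=> y; apply: continuous_comp; last exact: continuous_expR.
    by apply: continuousM; [exact: cst_continuous|exact: coord_continuous].
have [p pO pmax] := EVT_max_rV clO0 clOc E_cont.
have E_gt0 x : Omega x -> 0 < E x.
  by move=> /u_gt0 ux; rewrite !mulr_gt0// expR_gt0.
(* E vanishes on the boundary, so its maximum is interior. *)
have Op : Omega p.
  apply: contrapT => nOp.
  have up0 : u p = 0.
    apply: u_bd; split; first by rewrite inE in pO.
    by rewrite (interior_id _).1.
  have := pmax _ (mem_set (subO _ Ox0)).
  by rewrite {2}/E up0 !mul0r leNgt E_gt0.
have up := u_gt0 _ Op.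
have upM : u p <= M by exact: cmax.
have lnE x : Omega x -> ln (u x) + u x ^+ 3 - k * x 0 0 = ln (E x).
  move=> /u_gt0 ux.
  rewrite /E !lnM ?posrE ?mulr_gt0 ?expR_gt0// !expRK; ring.
have Onear : \forall x \near p, Omega x by exact: open_nbhs_nbhs.
have [_ du1] := u_smooth 2%N.
(* Both axes at once: -k x_0 contributes the slope k along the first axis and
   0 along the second. *)
have test i : let l : R := (i == 0)%:R * k in
    ((u p)^-1 + 3 * u p ^+ 2) * partial i u p = l /\
    ((u p)^-1 + 3 * u p ^+ 2) * partial i (partial i u) p
      + (6 * u p - (u p)^-1 ^+ 2) * partial i u p ^+ 2 <= 0.
  move=> l.
  pose e : 'rV[R]_2 := delta_mx 0 i.
  have Ol : \forall t \near (0 : R), Omega (t *: e + p) by exact: near_along_line.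
  have [u1 [_ u2]] := du1 i.
  have := @barrier_max_along_line R (fun t => u (t *: e + p))
     (fun t => partial i u (t *: e + p)) 0 l (partial i (partial i u) p).
  rewrite scale0r add0r; apply.
  - near=> t; apply: is_derive_along_line; apply: u1; near: t; exact: Ol.
  - have := @is_derive_along_line R 2 (partial i u) p e 0.
    by rewrite scale0r add0r; apply; exact: (u2 i).1.
  - by near=> t; apply: u_gt0; near: t; exact: Ol.
  - near=> t.
    have Ot : Omega (t *: e + p) by near: t; exact: Ol.
    have : ln (E (t *: e + p)) <= ln (E p).
      by rewrite ler_ln ?posrE ?E_gt0// pmax// inE; exact: subO.
    have -> : l * t = k * (t *: e + p) 0 0 - k * p 0 0.
      by rewrite !mxE eq_refl (eq_sym 0 i) /= /l; ring.
    rewrite -(lnE _ Ot) -(lnE _ Op) mulr0.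
    have shift (X Y s s' : R) : X - s <= Y - s' -> X - (s - s') <= Y - 0 by lra.
    exact: shift.
have [p0 q0] := test 0.
have [p1 q1] := test 1.
have r0 : 0 < (u p)^-1 + 3 * u p ^+ 2.
  by rewrite addr_gt0 ?invr_gt0// mulr_gt0// exprn_gt0.
have {}p1 : partial 1 u p = 0.
  by apply/eqP; move/eqP: p1; rewrite mul0r mulf_eq0 (gt_eqF r0).
rewrite /= mul1r in p0.
have {}q1 : partial 1 (partial 1 u) p <= 0.
  by move: q1; rewrite p1 expr0n/= mulr0 addr0 pmulr_rle0.
have du2 i j : derivable (partial j u) p (delta_mx 0 i).
  by have [_ [_ u2]] := du1 j; exact: (u2 i).1.
apply: (horo_equation_barrier _ _ _ _ _ _ _ up upM erefl p0 q0 q1).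
rewrite -(div_normalized_grad_aligned _ _ _ du2 p1) (pde _ Op).
by rewrite sqr_enorm_grad_aligned.
Unshelve. all: by end_near. Qed.
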